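(* Let $X_0$ be a real random variable whose density is supported on $[c,\infty)$ for some $c\in\mathbb R$, and let $\mathbf X=(X_1,\dots,X_d)$ be a random vector (with density) such that $X_0$ and $\mathbf X$ are independent. Let $\mathbf Z=(X_0,\mathbf X+X_0\boldsymbol 1)=(X_0,X_1+X_0,\dots,X_d+X_0)$. Then: 1. $\mathbf Z$ is $\mathrm{MTP}_2$ if and only if $\mathbf X$ is strongly $\mathrm{MTP}_2$. 2. $\mathbf Z$ is strongly $\mathrm{MTP}_2$ if and only if both $X_0$ and $\mathbf X$ are strongly $\mathrm{MTP}_2$.
   Context: $\boldsymbol 1$ is the vector of ones; $\vee,\wedge$ are componentwise maximum and minimum. A function $f:\mathbb R^m\to\mathbb R$ is $\mathrm{MTP}_2$ (multivariate totally positive of order 2) if $f(\mathbf x\vee\mathbf y)f(\mathbf x\wedge\mathbf y)\ge f(\mathbf x)f(\mathbf y)$ for all $\mathbf x,\mathbf y\in\mathbb R^m$. It is strongly $\mathrm{MTP}_2$ if $f(\mathbf x\vee(\mathbf y-\alpha\boldsymbol 1))\,f((\mathbf x+\alpha\boldsymbol 1)\wedge\mathbf y)\ge f(\mathbf x)f(\mathbf y)$ for all $\mathbf x,\mathbf y\in\mathbb R^m$ and all $\alpha\ge 0$. A random vector with Lebesgue density is (strongly) $\mathrm{MTP}_2$ if its density is. The support of a density is the smallest closed set over which the density integrates to 1. The density of $\mathbf Z$ is taken to be $f(z_0,\mathbf z)=f_{X_0}(z_0)f_{\mathbf X}(\mathbf z-z_0\boldsymbol 1)$. *)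

(* Defs.v *)
From HB Require Import structures.
From mathcomp Require Import all_boot all_order all_algebra.
From mathcomp Require Import all_classical all_reals all_analysis.
From mathcomp Require Import measurable_realfun.

Set Implicit Arguments.
Unset Strict Implicit.
Unset Printing Implicit Defensive.

Import Order.TTheory GRing.Theory Num.Theory.
Import numFieldNormedType.Exports.

Local Open Scope classical_set_scope.
Local Open Scope ring_scope.

(* R^n with its product sigma-algebra. [measurableTypeR R] is R as the Borel
   measurable space that carries [lebesgue_measure]; R itself is equipped with
   the same sigma-algebra under another display. *)
Notation Rn R n := (n.-tuple (measurableTypeR R)).

Section lebesgue_cons.
Context {R : realType} (n : nat).
Local Open Scope ereal_scope.

Definition tuple_cons_pair (p : measurableTypeR R * Rn R n) : Rn R n.+1 :=
  [tuple of p.1 :: p.2].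

Lemma measurable_tuple_cons_pair :
  measurable_fun [set: measurableTypeR R * Rn R n] tuple_cons_pair.
Proof. by apply: (@measurable_cons _ _ _ _ fst n snd). Qed.

Variable mu : {sigma_finite_measure set (Rn R n) -> \bar R}.

Definition lebesgue_cons : set (Rn R n.+1) -> \bar R :=
  pushforward (lebesgue_measure \x mu) tuple_cons_pair.

Let lebesgue_consE A :
  lebesgue_cons A = (lebesgue_measure \x mu) (tuple_cons_pair @^-1` A).
Proof. by []. Qed.

Let lebesgue_cons0 : lebesgue_cons set0 = 0.
Proof. by rewrite lebesgue_consE preimage_set0 measure0. Qed.

Let lebesgue_cons_ge0 A : 0 <= lebesgue_cons A.
Proof. by rewrite lebesgue_consE measure_ge0. Qed.

Let mpre (A : set (Rn R n.+1)) :
  measurable A -> measurable (tuple_cons_pair @^-1` A).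
Proof.
by move=> mA; rewrite -[X in measurable X]setTI; exact: measurable_tuple_cons_pair.
Qed.

Let lebesgue_cons_sigma_additive : semi_sigma_additive lebesgue_cons.
Proof.
move=> F mF tF mUF; rewrite /lebesgue_cons /pushforward preimage_bigcup.
apply: (@measure_semi_sigma_additive _ _ _ (lebesgue_measure \x mu)
  (fun i => tuple_cons_pair @^-1` F i)).
- by move=> i; exact: (mpre (mF i)).
- apply/trivIsetP => /= i j _ _ ij; rewrite -preimage_setI.
  by move/trivIsetP : tF => /(_ _ _ _ _ ij) ->//; rewrite preimage_set0.
- by rewrite -preimage_bigcup; exact: (mpre mUF).
Qed.

HB.instance Definition _ := isMeasure.Build _ _ _ lebesgue_cons
  lebesgue_cons0 lebesgue_cons_ge0 lebesgue_cons_sigma_additive.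

Let lebesgue_cons_sigma_finite : sigma_finite setT lebesgue_cons.
Proof.
have /sigma_finiteP[F [UF ndF Foo]] := sigma_finiteT (@lebesgue_measure R).
have /sigma_finiteP[G [UG ndG Goo]] := sigma_finiteT mu.
pose g (z : Rn R n.+1) : measurableTypeR R * Rn R n :=
  (thead z, [tuple of behead z]).
have mg : measurable_fun setT g.
  by apply: measurable_fun_pair; [exact: measurable_tnth|exact: measurable_behead].
have gK p : g (tuple_cons_pair p) = p.
  by case: p => a t; rewrite /g /tuple_cons_pair theadE; congr pair; exact: val_inj.
exists (fun k => g @^-1` (F k `*` G k)).
  apply/seteqP; split => // z _.
  have [i _ Fi] : (\bigcup_i F i) (g z).1 by rewrite -UF.
  have [j _ Gj] : (\bigcup_i G i) (g z).2 by rewrite -UG.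
  exists (maxn i j) => //; split.
    by move: Fi; exact/subsetPset/ndF/leq_maxl.
  by move: Gj; exact/subsetPset/ndG/leq_maxr.
move=> k; have [mF Fk] := Foo k; have [mG Gk] := Goo k; split.
  by rewrite -[X in measurable X]setTI; apply: mg => //; exact: measurableX.
rewrite lebesgue_consE -comp_preimage (_ : _ \o _ = id) ?preimage_id.
  by rewrite product_measure1E// lte_mul_pinfty// ge0_fin_numE.
by apply/funext => p /=; rewrite gK.
Qed.

HB.instance Definition _ := Measure_isSigmaFinite.Build _ _ _ lebesgue_cons
  lebesgue_cons_sigma_finite.

End lebesgue_cons.

(* Lebesgue measure on R^n as an n-fold product of [lebesgue_measure]; on the
   one-point space R^0 it is the unit mass. *)
Fixpoint lebesgue_tuple {R : realType} (n : nat) :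
    {sigma_finite_measure set (Rn R n) -> \bar R} :=
  match n with
  | 0 => dirac [tuple]
  | n'.+1 => lebesgue_cons (lebesgue_tuple n')
  end.

Section componentwise.
Context {R : realType} (n : nat).
Implicit Types x y : Rn R n.

Definition tuple_max x y : Rn R n :=
  [tuple Num.max (tnth x i) (tnth y i) | i < n].
Definition tuple_min x y : Rn R n :=
  [tuple Num.min (tnth x i) (tnth y i) | i < n].
Definition tuple_shift x (a : R) : Rn R n := [tuple tnth x i + a | i < n].

Definition MTP2 (f : Rn R n -> R) : Prop :=
  forall x y, f x * f y <= f (tuple_max x y) * f (tuple_min x y).

Definition strongly_MTP2 (f : Rn R n -> R) : Prop :=
  forall x y (a : R), 0 <= a ->
  f x * f y <=
    f (tuple_max x (tuple_shift y (- a))) * f (tuple_min (tuple_shift x a) y).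

End componentwise.

Section random_vectors.
Context {dO : measure_display} {Omega : measurableType dO} {R : realType}.
Variable P : probability Omega R.

Definition has_density {dT : measure_display} {T : measurableType dT}
    (mu : {measure set T -> \bar R}) (X : {RV P >-> T}) (f : T -> R) : Prop :=
  [/\ measurable_fun setT f,
      (forall x, 0 <= f x) &
      forall A, measurable A ->
        distribution P X A = (\int[mu]_(x in A) (f x)%:E)%E].

Definition independent_RV {dT dT' : measure_display}
    {T : measurableType dT} {T' : measurableType dT'}
    (X : {RV P >-> T}) (Y : {RV P >-> T'}) : Prop :=
  forall A B, measurable A -> measurable B ->
    P (X @^-1` A `&` Y @^-1` B) = (P (X @^-1` A) * P (Y @^-1` B))%E.

(* X is a random vector with Lebesgue density f, and f is (strongly) MTP2. *)
Definition RV_MTP2 n (X : {RV P >-> Rn R n}) (f : Rn R n -> R) : Prop :=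
  has_density (lebesgue_tuple n) X f /\ MTP2 f.

Definition RV_strongly_MTP2 n (X : {RV P >-> Rn R n})
    (f : Rn R n -> R) : Prop :=
  has_density (lebesgue_tuple n) X f /\ strongly_MTP2 f.

(* The case m = 1, with R^1 identified with R. *)
Definition RV_strongly_MTP2_real (X : {RV P >-> measurableTypeR R})
    (f : measurableTypeR R -> R) : Prop :=
  has_density lebesgue_measure X f /\
  strongly_MTP2 (fun t : Rn R 1 => f (thead t)).

End random_vectors.

(* The intersection of the closed sets over which f integrates to 1, which is
   itself such a set because R is second countable. *)
Definition density_support {R : realType} (f : measurableTypeR R -> R) : set R :=
  \bigcap_(C in [set C : set R | closed C /\
    (\int[lebesgue_measure]_(x in C) (f x)%:E = 1)%E]) C.

Section shifted_vector.
Context {dO : measure_display} {Omega : measurableType dO} {R : realType}.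
Variables (P : probability Omega R) (d : nat).
Variables (X0 : {RV P >-> measurableTypeR R}) (X : {RV P >-> Rn R d}).

Definition Zvec (w : Omega) : Rn R d.+1 :=
  [tuple of X0 w :: tuple_shift (X w) (X0 w)].

Let measurable_Zvec : measurable_fun setT Zvec.
Proof.
have mX0 : measurable_fun [set: Omega] (X0 : Omega -> R) :=
  @measurable_funPT _ _ _ _ X0.
apply: measurable_cons; first exact: mX0.
apply/measurable_fun_tnthP => i.
have mXi : measurable_fun [set: Omega] ((fun w => tnth (X w) i) : Omega -> R) :=
  measurableT_comp (measurable_tnth i) (@measurable_funPT _ _ _ _ X).
have := measurable_funD mXi mX0.
rewrite (_ : _ \o _ = (fun w => tnth (X w) i + X0 w)); first by [].
by apply/funext => w /=; rewrite tnth_mktuple.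
Qed.

HB.instance Definition _ := isMeasurableFun.Build _ _ _ _ Zvec measurable_Zvec.

Definition Z_RV : {RV P >-> Rn R d.+1} := Zvec.

End shifted_vector.

(* f(z0, z) = f0(z0) fX(z - z0 1) *)
Definition Z_density {R : realType} (d : nat) (f0 : measurableTypeR R -> R)
    (fX : Rn R d -> R) (z : Rn R d.+1) : R :=
  f0 (thead z) * fX (tuple_shift [tuple of behead z] (- thead z)).

(* Main.v *)
(* In the coordinates (t, u) |-> (t, u + t 1) the density of Z is f0(t) fX(u), and
   the MTP2 inequality for Z between the fibres over t <= s is, when f0(s) and
   f0(t) are positive, the strong MTP2 inequality for fX with shift s - t.  The
   shifts for which that inequality holds are closed under addition; since
   {f0 > 0} has positive measure, Steinhaus' theorem provides all sufficiently
   small shifts, hence all of them.  Strong MTP2 of Z yields that of f0 by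
   comparing two points with the same u such that fX(u) > 0. *)

Require Import Defs.
From HB Require Import structures.
From mathcomp Require Import all_boot all_order all_algebra.
From mathcomp Require Import all_classical all_reals all_analysis.
From mathcomp Require Import measurable_realfun ring lra.

Set Implicit Arguments.
Unset Strict Implicit.
Unset Printing Implicit Defensive.

Import Order.TTheory GRing.Theory Num.Theory.
Import numFieldNormedType.Exports.

Local Open Scope classical_set_scope.
Local Open Scope ring_scope.

Ltac no_minmax t := lazymatch t with
  | context [Order.max _ _] => fail
  | context [Order.min _ _] => fail
  | _ => idtac
  end.

(* Innermost extrema are resolved first, so that the recorded comparisons
   mention no [min] or [max]. *)
Ltac lra_minmax := repeat match goal with
  | |- context [Order.max ?x ?y] =>
      no_minmax x; no_minmax y; case: (leP x y) => ?
  | |- context [Order.min ?x ?y] =>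
      no_minmax x; no_minmax y; case: (leP x y) => ?
  end; lra.

(** * Componentwise operations on tuples *)

Section tuple_operations.
Context {R : realType}.

Lemma thead_tuple_max n (x y : Rn R n.+1) :
  thead (tuple_max x y) = Num.max (thead x) (thead y).
Proof. by rewrite /thead tnth_mktuple. Qed.

Lemma thead_tuple_min n (x y : Rn R n.+1) :
  thead (tuple_min x y) = Num.min (thead x) (thead y).
Proof. by rewrite /thead tnth_mktuple. Qed.

Lemma thead_tuple_shift n (x : Rn R n.+1) a :
  thead (tuple_shift x a) = thead x + a.
Proof. by rewrite /thead tnth_mktuple. Qed.

Lemma tuple_shift0 n (x : Rn R n) : tuple_shift x 0 = x.
Proof. by apply: eq_from_tnth => i; rewrite tnth_mktuple addr0. Qed.

Lemma tuple_shift_cons n t (u : Rn R n) a :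
  tuple_shift [tuple of t :: u] a = tuple_cons_pair (t + a, tuple_shift u a).
Proof.
apply: eq_from_tnth => i; rewrite tnth_mktuple.
by case: (unliftP ord0 i) => [j ->|->]; rewrite ?tnth0// !tnthS tnth_mktuple.
Qed.

Lemma tuple_maxC n (x y : Rn R n) : tuple_max x y = tuple_max y x.
Proof. by apply: eq_from_tnth => i; rewrite !tnth_mktuple maxC. Qed.

Lemma tuple_minC n (x y : Rn R n) : tuple_min x y = tuple_min y x.
Proof. by apply: eq_from_tnth => i; rewrite !tnth_mktuple minC. Qed.

Lemma strongly_MTP2W n (f : Rn R n -> R) : strongly_MTP2 f -> MTP2 f.
Proof. by move=> + x y => /(_ x y 0 (lexx _)); rewrite oppr0 !tuple_shift0. Qed.

End tuple_operations.

(** * Strong MTP2 one shift at a time *)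

Section MTP2_at.
Context {R : realType} (n : nat).
Implicit Types (g : Rn R n -> R) (u v : Rn R n) (a b : R).

(** The shift is fixed here, so that the admissible shifts form a set that can be studied on its
    own; [strongly_MTP2 g] says that it contains every [a >= 0]. *)
Definition MTP2_at g a := forall u v,
  g u * g v <=
    g (tuple_max u (tuple_shift v (- a))) * g (tuple_min (tuple_shift u a) v).

(* The inequalities for the pairs (u, w) and (m, v) below multiply to the desired
   one for (u, v), up to the common factor g m * g w; both factors are positive
   as soon as g u * g v is. *)
Lemma MTP2_at_add g a b : (forall u, 0 <= g u) -> 0 <= a -> 0 <= b ->
  MTP2_at g a -> MTP2_at g b -> MTP2_at g (a + b).
Proof.
move=> g0 a0 b0 ga gb u v.
have [guv|guv0] := leP (g u * g v) 0.
  by rewrite (le_trans guv)// mulr_ge0.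
pose m := tuple_min (tuple_shift u a) v.
pose w := tuple_max m (tuple_shift v (- b)).
have gm : 0 < g m.
  rewrite lt_neqAle g0 andbT eq_sym; apply/eqP => gm0.
  by have := ga u v; rewrite -/m gm0 mulr0 leNgt guv0.
have gv : 0 < g v.
  rewrite lt_neqAle g0 andbT eq_sym; apply: contraTN guv0 => /eqP ->.
  by rewrite mulr0 ltxx.
have gw : 0 < g w.
  rewrite lt_neqAle g0 andbT eq_sym; apply/eqP => gw0.
  by have := gb m v; rewrite -/w gw0 mul0r leNgt mulr_gt0.
have := ga u w; have := gb m v; rewrite -/w.
(* The next three identities are absorptions: [m] lies below both [u + a] and [v], and [v - b] lies
   below [v]. *)
have -> : tuple_max u (tuple_shift w (- a)) =
    tuple_max u (tuple_shift v (- (a + b))).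
  by apply: eq_from_tnth => i; rewrite !tnth_mktuple; lra_minmax.
have -> : tuple_min (tuple_shift u a) w = m.
  by apply: eq_from_tnth => i; rewrite !tnth_mktuple; lra_minmax.
have -> : tuple_min (tuple_shift m b) v = tuple_min (tuple_shift u (a + b)) v.
  by apply: eq_from_tnth => i; rewrite !tnth_mktuple; lra_minmax.
move=> gb' ga'; rewrite -(@ler_pM2r _ (g m * g w)) ?mulr_gt0//.
have := ler_pM (mulr_ge0 (g0 _) (g0 _)) (mulr_ge0 (g0 _) (g0 _)) ga' gb'.
by congr (_ <= _); ring.
Qed.

(** Any [a >= 0] is a sum of finitely many equal shifts smaller than [e], and admissible shifts add
    up. *)
Lemma MTP2_at_extend g e : (forall u, 0 <= g u) -> 0 < e ->
  (forall a, 0 <= a < e -> MTP2_at g a) -> strongly_MTP2 g.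
Proof.
move=> g0 e0 ge u v a a0.
suff: MTP2_at g a by apply.
have [k ak] : exists k : nat, a / k.+1%:R < e.
  (* The integer part of [a / e] plus one strictly exceeds [a / e]. *)
  exists (Num.truncn (a / e)); rewrite ltr_pdivrMr// mulrC -ltr_pdivrMr//.
  exact: truncnS_gt.
have ak0 : 0 <= a / k.+1%:R by rewrite divr_ge0.
rewrite -[a](@divfK _ k.+1%:R)// mulr_natr.
move: (_ / _) ak0 ak => b b0 be; elim: (k.+1) => [|j IH].
  by rewrite mulr0n; apply: ge; rewrite lexx.
rewrite mulrS; apply: MTP2_at_add => //; first by rewrite mulrn_wge0.
by apply: ge; rewrite b0.
Qed.

End MTP2_at.

(** * MTP2 inequalities in sheared coordinates *)

Section Z_density_MTP2.
Context {R : realType} (d : nat) (f0 : measurableTypeR R -> R) (g : Rn R d -> R).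
Hypotheses (f0_ge0 : forall t, 0 <= f0 t) (g_ge0 : forall u, 0 <= g u).

(** The map that sends [(X0 w, X w)] to [Zvec X0 X w]. *)
Definition shear (t : R) (u : Rn R d) : Rn R d.+1 :=
  [tuple of t :: tuple_shift u t].

Lemma Z_density_shear t u : Z_density f0 g (shear t u) = f0 t * g u.
Proof.
have E : [tuple of behead (shear t u)] = tuple_shift u t :> Rn R d.
  exact: val_inj.
rewrite /Z_density theadE [X in tuple_shift X _]E; congr (_ * g _).
by apply: eq_from_tnth => i; rewrite !tnth_mktuple addrK.
Qed.

Lemma shearP (z : Rn R d.+1) : exists t u, z = shear t u.
Proof.
exists (thead z), (tuple_shift [tuple of behead z] (- thead z)).
rewrite /shear (_ : tuple_shift (tuple_shift _ _) _ = [tuple of behead z]).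
  by rewrite [LHS]tuple_eta; exact: val_inj.
by apply: eq_from_tnth => i; rewrite !tnth_mktuple subrK.
Qed.

(** Since [t - a <= s], the first coordinate of the maximum is [s]; taking [s] out of the others
    turns the offset [t - a] of [v] into [- (s - t + a)]. *)
Lemma shear_max s t a u v : t - a <= s ->
  tuple_max (shear s u) (tuple_shift (shear t v) (- a)) =
  shear s (tuple_max u (tuple_shift v (- (s - t + a)))).
Proof.
move=> tas; apply: eq_from_tnth => i; rewrite !tnth_mktuple.
case: (unliftP ord0 i) => [j ->|->]; last first.
  by rewrite !tnth0 max_l.
by rewrite !tnthS !tnth_mktuple; lra_minmax.
Qed.

Lemma shear_min s t a u v : t - a <= s ->
  tuple_min (tuple_shift (shear s u) a) (shear t v) =
  shear t (tuple_min (tuple_shift u (s - t + a)) v).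
Proof.
move=> tas; apply: eq_from_tnth => i; rewrite !tnth_mktuple.
case: (unliftP ord0 i) => [j ->|->]; last first.
  by rewrite !tnth0 min_r -?lerBlDr.
by rewrite !tnthS !tnth_mktuple; lra_minmax.
Qed.

(* In the sheared coordinates the remaining case reduces to the previous one by
   exchanging the roles of the two points. *)
Lemma shear_max_lt s t a u v : s <= t - a ->
  tuple_max (shear s u) (tuple_shift (shear t v) (- a)) =
  shear (t - a) (tuple_max v (tuple_shift u (- (t - a - s)))).
Proof.
move=> tas; apply: eq_from_tnth => i; rewrite !tnth_mktuple.
case: (unliftP ord0 i) => [j ->|->]; last first.
  by rewrite !tnth0 max_r.
by rewrite !tnthS !tnth_mktuple; lra_minmax.
Qed.

Lemma shear_min_lt s t a u v : s <= t - a ->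
  tuple_min (tuple_shift (shear s u) a) (shear t v) =
  shear (s + a) (tuple_min (tuple_shift v (t - a - s)) u).
Proof.
move=> tas; apply: eq_from_tnth => i; rewrite !tnth_mktuple.
case: (unliftP ord0 i) => [j ->|->]; last first.
  by rewrite !tnth0 min_l -?lerBrDr.
by rewrite !tnthS !tnth_mktuple; lra_minmax.
Qed.

Lemma Z_density_MTP2 : strongly_MTP2 g -> MTP2 (Z_density f0 g).
Proof.
move=> gM x y; wlog : x y / thead y <= thead x.
  move=> WL; have [|/ltW] := leP (thead y) (thead x); first exact: WL.
  by rewrite tuple_maxC tuple_minC (mulrC (Z_density _ _ x)); exact: WL.
have [s [u ->]] := shearP x; have [t [v ->]] := shearP y.
rewrite !theadE => ts.
(* Plain MTP2 is the instance [a = 0], which leaves the shift [s - t] for [g]. *)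
have := @shear_max s t 0 u v; have := @shear_min s t 0 u v.
rewrite oppr0 !tuple_shift0 !addr0 => -> // -> //.
rewrite !Z_density_shear mulrACA [leRHS]mulrACA ler_wpM2l ?mulr_ge0//.
by apply: gM; rewrite subr_ge0.
Qed.

(** If [t - a <= s], both sides share the factor [f0 s * f0 t]. Otherwise the new heads are [t - a]
    and [s + a]: the [f0] factors are compared by strong MTP2 of [f0], the [g] factors by that of
    [g] with the two points exchanged. *)
Lemma Z_density_strongly_MTP2 :
  strongly_MTP2 (fun t : Rn R 1 => f0 (thead t)) -> strongly_MTP2 g ->
  strongly_MTP2 (Z_density f0 g).
Proof.
move=> f0M gM x y a a0.
have [s [u ->]] := shearP x; have [t [v ->]] := shearP y.
have := f0M [tuple of [:: s]] [tuple of [:: t]] a a0.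
rewrite thead_tuple_max thead_tuple_min !thead_tuple_shift !theadE.
have [ts|st] := leP (t - a) s => Hf.
  rewrite shear_max// shear_min// !Z_density_shear mulrACA [leRHS]mulrACA.
  rewrite ler_wpM2l ?mulr_ge0//; apply: gM; lra.
rewrite (shear_max_lt _ _ (ltW st)) (shear_min_lt _ _ (ltW st)) !Z_density_shear.
rewrite mulrACA [leRHS]mulrACA; apply: ler_pM; rewrite ?mulr_ge0//.
  by move: Hf; rewrite min_l//; lra.
rewrite mulrC; apply: gM; lra.
Qed.

Lemma Z_density_MTP2_at s t : MTP2 (Z_density f0 g) -> 0 < f0 s -> 0 < f0 t ->
  t <= s -> MTP2_at g (s - t).
Proof.
move=> ZM fs ft ts u v; have := ZM (shear s u) (shear t v).
have := @shear_max s t 0 u v; have := @shear_min s t 0 u v.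
rewrite oppr0 !tuple_shift0 !addr0 => -> // -> //.
by rewrite !Z_density_shear mulrACA [leRHS]mulrACA ler_pM2l ?mulr_gt0.
Qed.

Lemma Z_density_strongly_MTP2_f0 p : 0 < g p ->
  strongly_MTP2 (Z_density f0 g) ->
  strongly_MTP2 (fun t : Rn R 1 => f0 (thead t)).
Proof.
move=> gp ZM x y a a0.
rewrite thead_tuple_max thead_tuple_min !thead_tuple_shift.
move: (thead x) (thead y) => s t.
(* In the first case the maximum is [s] and the minimum is [t], so both sides agree. *)
have [ts|st] := leP (t - a) s.
  by rewrite min_r//; lra.
rewrite min_l; last lra.
have := ZM (shear s p) (shear t p) a a0.
rewrite (shear_max_lt _ _ (ltW st)) (shear_min_lt _ _ (ltW st)).
(* The shift [t - a - s] is positive, so both extrema return [p] and the factor [g p * g p]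
   cancels. *)
have -> : tuple_max p (tuple_shift p (- (t - a - s))) = p.
  apply: eq_from_tnth => i; rewrite !tnth_mktuple max_l//; lra.
have -> : tuple_min (tuple_shift p (t - a - s)) p = p.
  apply: eq_from_tnth => i; rewrite !tnth_mktuple min_r//; lra.
by rewrite !Z_density_shear mulrACA [leRHS]mulrACA ler_pM2r ?mulr_gt0.
Qed.

End Z_density_MTP2.

(** * Translation on the line and Steinhaus' theorem *)

Section steinhaus.
Context {R : realType}.
Local Notation mu := (@lebesgue_measure R).

Lemma measurable_addr (a : R) :
  measurable_fun [set: measurableTypeR R]
    (fun x : measurableTypeR R => (x + a : measurableTypeR R)).
Proof. exact: measurable_funD. Qed.

Lemma lebesgue_measureD (a : R) (A : set (measurableTypeR R)) : measurable A ->
  mu ((fun x => x + a) @^-1` A) = mu A.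
Proof.
move=> mA.
rewrite -[LHS]/(pushforward mu
  (fun x : measurableTypeR R => x + a : measurableTypeR R) A).
(* It suffices to compare the two measures on half-open intervals. *)
apply/esym; apply: lebesgue_measure_unique => //.
  exact: measurable_addr.
move=> ? _ [[b c]] _ <-.
rewrite /= /pushforward.
have -> : (+%R^~ a) @^-1` `]b, c]%classic = `]b - a, c - a]%classic.
  by apply/seteqP; split => x /=; rewrite !in_itv/= ltrBlDr lerBrDr.
rewrite !lebesgue_measure_itv/= !lte_fin ltrD2r.
by case: ifPn => // _; rewrite -!EFinD; congr EFin; ring.
Qed.

(* Near a density point x, A fills more than 3/4 of a ball of radius r; if its
   trace missed its translate by a < r / 2, the two would not fit in the ball of
   radius r + a. *)
Lemma steinhaus (A : set (measurableTypeR R)) : measurable A -> (0 < mu A)%E ->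
  exists2 e : R, 0 < e &
    forall a, 0 <= a < e -> exists s t, [/\ A s, A t & s - t = a].
Proof.
move=> mA muA.
have [x [Ax cvx]] : exists x, A x /\
    (mu (A `&` ball x r) * (mu (ball x r))^-1)%E @[r --> 0^'+] --> (1%:E : \bar R).
  have [N [mN N0 AN]] := lebesgue_density mA.
  (* Without a density point in [A], all of [A] would lie in the exceptional null set [N]. *)
  apply/not_existsP => noA; move: muA; rewrite ltNge => /negP; apply.
  rewrite -N0; apply: le_measure; rewrite ?inE// => x Ax; apply: AN => /= H.
  by apply: (noA x); split => //; move: H; rewrite indicE mem_set.
have [r r0 Ar] : exists2 r : R, 0 < r & ((3 / 2 * r)%:E < mu (A `&` ball x r))%E.
  have near34 : \forall r \near 0^'+,
      ((3 / 4)%:E < mu (A `&` ball x r) * (mu (ball x r))^-1)%E.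
    apply: (cvx [set y | ((3 / 4)%:E < y)%E]).
    apply: open_nbhs_nbhs; split; first exact: open_ereal_gt_ereal.
    by rewrite /= lte_fin; lra.
  have [r [r0 Hr]] := @filter_ex _ (0^'+ : set_system R) _ _
    (@filterI _ _ _ _ _ (nbhs_right_gt (0 : R)) near34).
  exists r => //; move: Hr; rewrite lebesgue_measure_ball ?ltW// inver.
  rewrite mulrn_eq0/= gt_eqF// lte_pdivlMr ?mulrn_wgt0// -EFinM.
  by rewrite (_ : 3 / 4 * (r *+ 2) = 3 / 2 * r)// -mulr_natr; field.
have mAB : measurable (A `&` ball x r : set (measurableTypeR R)).
  by apply: measurableI => //; exact: measurable_ball.
exists (r / 2) => [|a /andP[a0 ar]]; first by rewrite divr_gt0.
pose E := A `&` ball x r : set (measurableTypeR R).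
pose Ea := (fun y => y + - a) @^-1` E : set (measurableTypeR R).
have mEa : measurable Ea.
  by rewrite -[Ea]setTI; exact: measurable_addr.
have [[z [Ez Eaz]]|noz] := pselect (exists z, E z /\ Ea z).
  exists z, (z - a).
  by split; [case: Ez|case: Eaz|rewrite opprB addrC subrK].
(* The disjoint sets [E] and [Ea] have total measure above [3 * r], whereas the ball has length
   [2 * (r + a) < 3 * r]. *)
have : (mu (E `|` Ea) <= mu (ball x (r + a) : set (measurableTypeR R)))%E.
  apply: le_measure; rewrite ?inE; [exact: measurableU|exact: measurable_ball|].
  move=> z; rewrite /Ea /E /= /ball/= => -[[_]|[_]]; first by lra.
  by rewrite !ltr_norml; lra.
rewrite measureU//; last first.
  by apply/seteqP; split => // z [Ez Eaz]; case: noz; exists z.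
rewrite [X in (_ + X)%E](lebesgue_measureD (- a) mAB).
rewrite lebesgue_measure_ball; last by rewrite addr_ge0// ltW.
rewrite leNgt (@lt_le_trans _ _ ((3 / 2 * r)%:E + (3 / 2 * r)%:E)%E)//.
  by rewrite -EFinD lte_fin -mulr_natr; lra.
by rewrite leeD// ltW.
Qed.

End steinhaus.

(** * Shift and shear invariance of Lebesgue measure *)

Section translation.
Context {R : realType}.
Local Open Scope ereal_scope.
Local Notation mu := (@lebesgue_measure R).

Lemma ge0_integral_addr (a : R) (h : measurableTypeR R -> \bar R) :
  measurable_fun setT h -> (forall x, 0 <= h x) ->
  \int[mu]_x h (x + a)%R = \int[mu]_x h x.
Proof.
move=> mh h0.
rewrite -[LHS](ge0_integral_pushforward (measurable_addr a) mu measurableT mh)//.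
apply: eq_measure_integral; first exact: measurable_addr.
by move=> ? A mA _; exact: lebesgue_measureD.
Qed.

Lemma measurable_tuple_shift n dT (T : measurableType dT)
    (f : T -> Rn R n) (s : T -> measurableTypeR R) :
  measurable_fun setT f -> measurable_fun setT s ->
  measurable_fun setT (fun x => tuple_shift (f x) (s x)).
Proof.
move=> mf ms; apply/measurable_fun_tnthP => i.
rewrite (_ : _ \o _ = (fun x => tnth (f x) i + s x)%R); last first.
  by apply/funext => x /=; rewrite tnth_mktuple.
have mfi : measurable_fun setT (fun x => tnth (f x) i : measurableTypeR R).
  exact: measurableT_comp (measurable_tnth i) mf.
exact: (measurable_funD mfi ms).
Qed.

(** Induction on [n] by slicing: the slice of the preimage at [t] is the shifted slice of [A] at
    [t + a]. The induction hypothesis removes the inner shift, and translation invariance on the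
    line the outer one. *)
Lemma lebesgue_tuple_shift n (a : R) (A : set (Rn R n)) : measurable A ->
  lebesgue_tuple n ((fun u => tuple_shift u a) @^-1` A) = lebesgue_tuple n A.
Proof.
elim: n A => [|n IH] A mA.
  rewrite (_ : (fun u => tuple_shift u a) = id) ?preimage_id//.
  by apply/funext => u; rewrite [LHS]tuple0 [RHS]tuple0.
pose B := @tuple_cons_pair R n @^-1` A.
have mB : measurable B.
  by rewrite -[B]setTI; exact: measurable_tuple_cons_pair.
rewrite /= /lebesgue_cons /pushforward.
rewrite -[RHS](ge0_integral_addr a)//; last exact: measurable_fun_xsection.
apply: eq_integral => t _ /=.
rewrite -[RHS]IH; last exact: measurable_xsection.
congr (lebesgue_tuple n _); apply/seteqP; split => u;
  by rewrite /xsection /= !inE /= tuple_shift_cons.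
Qed.

(** On the fibre over [t] the shear is the translation by [t], so it preserves the measure of every
    slice. *)
Lemma lebesgue_tuple_shear n (A : set (Rn R n.+1)) : measurable A ->
  (mu \x lebesgue_tuple n) ((fun p => shear p.1 p.2) @^-1` A) =
  lebesgue_tuple n.+1 A.
Proof.
move=> mA.
pose B := @tuple_cons_pair R n @^-1` A.
have mB : measurable B.
  by rewrite -[B]setTI; exact: measurable_tuple_cons_pair.
apply: eq_integral => t _ /=.
rewrite -[RHS](lebesgue_tuple_shift t); last exact: measurable_xsection.
congr (lebesgue_tuple n _); apply/seteqP; split => u;
  by rewrite /xsection /= !inE.
Qed.

End translation.

(** * Positivity sets and joint densities *)

(** If the density vanished outside a null set, its total integral would be 0 instead of 1. *)
Lemma has_density_gt0 dO (Omega : measurableType dO) (R : realType)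
    (P : probability Omega R) dT (T : measurableType dT)
    (mu : {measure set T -> \bar R}) (X : {RV P >-> T}) (f : T -> R) :
  has_density mu X f ->
  measurable [set x | 0 < f x] /\ (0 < mu [set x | (0 < f x)%R])%E.
Proof.
move=> [mf f0 Xf].
have mA : measurable [set x | 0 < f x].
  rewrite -[X in measurable X]setTI.
  rewrite (_ : [set x | 0 < f x] = f @^-1` `]0, +oo[%classic); first exact: mf.
  by apply/seteqP; split => x /=; rewrite in_itv/= andbT.
split => //; rewrite lt0e measure_ge0 andbT; apply/eqP => mu0.
have := Xf _ measurableT.
rewrite probability_setT (ge0_negligible_integral mA)//; first last.
- by move=> x _; rewrite lee_fin.
- exact/measurable_EFinP.
rewrite integral0_eq => [[/eqP]|x [_ /= /negP]]; first by rewrite oner_eq0.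
by rewrite -leNgt => fx; congr EFin; apply/le_anti; rewrite fx f0.
Qed.

Section densities.
Local Open Scope ereal_scope.

(** Packs the indefinite integral as a measure, so that uniqueness of the product measure applies to
    it. *)
Lemma integral_measure d (T : measurableType d) (R : realType)
    (mu : {measure set T -> \bar R}) (f : T -> \bar R) :
  measurable_fun setT f -> (forall x, 0 <= f x) ->
  exists m : {measure set T -> \bar R},
    forall A, measurable A -> m A = \int[mu]_(x in A) f x.
Proof.
move=> mf f0; pose m A := \int[mu]_(x in A) f x.
have m0 : m set0 = 0 by rewrite /m integral_set0.
have m_ge0 A : 0 <= m A by apply: integral_ge0.
have m_add : semi_sigma_additive m.
  move=> F mF tF mUF; rewrite /m ge0_integral_bigcup//; last first.
    exact: measurable_funTS.
  by apply: is_cvg_ereal_nneg_natsum => k _; exact: m_ge0.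
pose m' : {measure set T -> \bar R} :=
  HB.pack m (isMeasure.Build _ _ _ m m0 m_ge0 m_add).
by exists m'.
Qed.

(** The law of the pair and the measure with density [f p.1 * g p.2] both agree with the product of
    the marginal laws on rectangles, the former by independence and the latter by Tonelli; such a
    measure is unique. *)
Lemma independent_joint_density d (Omega : measurableType d) (R : realType)
    (P : probability Omega R) d1 d2 (T1 : measurableType d1)
    (T2 : measurableType d2) (m1 : {sigma_finite_measure set T1 -> \bar R})
    (m2 : {sigma_finite_measure set T2 -> \bar R})
    (X : {RV P >-> T1}) (Y : {RV P >-> T2}) (f : T1 -> R) (g : T2 -> R) :
  has_density m1 X f -> has_density m2 Y g -> independent_RV X Y ->
  forall A, measurable A -> P [set w | A (X w, Y w)] =
    \int[m1 \x m2]_(p in A) (f p.1 * g p.2)%:E.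
Proof.
move=> [mf f0 Xf] [mg g0 Yg] XY A mA.
have mfg : measurable_fun setT (fun p : T1 * T2 => (f p.1 * g p.2)%:E).
  apply/measurable_EFinP; apply: measurable_funM.
    exact: measurableT_comp mf measurable_fst.
  exact: measurableT_comp mg measurable_snd.
have fg0 (p : T1 * T2) : 0 <= (f p.1 * g p.2)%:E by rewrite lee_fin mulr_ge0.
have [m mE] := @integral_measure _ _ _ (m1 \x m2) _ mfg fg0.
rewrite -mE// -(@product_measure_unique _ _ _ _ _ (distribution P X)
  (distribution P Y))//; last first.
  move=> B C mB mC; rewrite mE; last exact: measurableX.
  rewrite integral_mkcond fubini_tonelli1; last 2 first.
  - exact/(measurable_restrictT _ (measurableX mB mC))/measurable_funTS.
  - by move=> p; apply: erestrict_ge0.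
  transitivity (\int[m1]_x
      (((EFin \o f) \_ B) x * \int[m2]_y ((EFin \o g) \_ C) y)).
    apply: eq_integral => x _; rewrite /fubini_F -ge0_integralZl//; last 3 first.
    - exact/(measurable_restrictT _ mC)/measurable_funTS/measurable_EFinP.
    - by move=> y _; apply: erestrict_ge0 => z; rewrite lee_fin.
    - by apply: erestrict_ge0 => z; rewrite lee_fin.
    apply: eq_integral => y _; rewrite !patchE in_setX/=.
    by case: (x \in B); case: (y \in C); rewrite ?mul0e ?mule0.
  rewrite ge0_integralZr//; last 3 first.
  - exact/(measurable_restrictT _ mB)/measurable_funTS/measurable_EFinP.
  - by move=> x _; apply: erestrict_ge0 => z; rewrite lee_fin.
  - by apply: integral_ge0 => y _; apply: erestrict_ge0 => z; rewrite lee_fin.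
  rewrite -!integral_mkcond; congr (_ * _); [exact/esym/Xf|exact/esym/Yg].
pose XYpair w := (X w, Y w).
have mXY : measurable_fun setT XYpair by exact: measurable_fun_pair.
pose pXY : {measure set (T1 * T2) -> \bar R} := pushforward P XYpair.
by rewrite (@product_measure_unique _ _ _ _ _ _ _ (pXY mXY)).
Qed.

End densities.

(** * The density of the shifted vector *)

Section Z_has_density.
Context {R : realType} (d : nat).

Lemma measurable_Z_density (f0 : measurableTypeR R -> R) (g : Rn R d -> R) :
  measurable_fun setT f0 -> measurable_fun setT g ->
  measurable_fun setT (Z_density f0 g).
Proof.
move=> mf mg.
have mt : measurable_fun setT (fun z : Rn R d.+1 => thead z).
  exact: measurable_tnth.
apply: measurable_funM; first exact: measurableT_comp mf mt.
apply: (measurableT_comp mg); apply: measurable_tuple_shift.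
  exact: measurable_behead.
exact: measurableT_comp.
Qed.

Lemma measurable_shear :
  measurable_fun setT (fun p : measurableTypeR R * Rn R d => shear p.1 p.2).
Proof.
apply: measurable_cons; first exact: measurable_fst.
by apply: measurable_tuple_shift; [exact: measurable_snd|exact: measurable_fst].
Qed.

(** The joint density of [X0] and [X] is [Z_density f0 fX] composed with the shear, and the shear
    preserves Lebesgue measure, so the change of variables brings in no Jacobian factor. *)
Lemma Z_has_density dO (Omega : measurableType dO) (P : probability Omega R)
    (X0 : {RV P >-> measurableTypeR R}) (X : {RV P >-> Rn R d}) f0 fX :
  has_density lebesgue_measure X0 f0 -> has_density (lebesgue_tuple d) X fX ->
  independent_RV X0 X ->
  has_density (lebesgue_tuple d.+1) (Z_RV X0 X) (Z_density f0 fX).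
Proof.
move=> X0f XfX X0X; have [mf0 f0_ge0 _] := X0f; have [mfX fX_ge0 _] := XfX.
have mZ := measurable_Z_density mf0 mfX.
split => // [z|A mA]; first exact: mulr_ge0.
pose S (p : measurableTypeR R * Rn R d) := shear p.1 p.2.
have mSA : measurable (S @^-1` A).
  by rewrite -[_ @^-1` _]setTI; exact: measurable_shear.
rewrite -[LHS]/(P [set w | (S @^-1` A) (X0 w, X w)]).
rewrite (independent_joint_density X0f XfX)//.
transitivity (\int[lebesgue_measure \x lebesgue_tuple d]_(p in S @^-1` A)
    (Z_density f0 fX (S p))%:E)%E.
  by apply: eq_integral => p _; rewrite Z_density_shear.
have mZE : measurable_fun A (fun z => (Z_density f0 fX z)%:E).
  exact/measurable_EFinP/measurable_funTS.
have Z0 : {in A, forall z, 0 <= (Z_density f0 fX z)%:E}%E.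
  by move=> z _; rewrite lee_fin mulr_ge0.
have push := ge0_integral_pushforward measurable_shear
  (lebesgue_measure \x lebesgue_tuple d)%E mA mZE Z0.
apply: etrans; first exact/esym/push.
apply: eq_measure_integral; first exact: measurable_shear.
by move=> ? B mB _; exact: lebesgue_tuple_shear.
Qed.

End Z_has_density.

Theorem theorem3p1 (R : realType) (dO : measure_display)
    (Omega : measurableType dO) (P : probability Omega R) (d : nat)
    (X0 : {RV P >-> measurableTypeR R}) (X : {RV P >-> Rn R d})
    (f0 : measurableTypeR R -> R) (fX : Rn R d -> R) (c : R) :
  (0 < d)%N ->
  has_density lebesgue_measure X0 f0 ->
  has_density (lebesgue_tuple d) X fX ->
  density_support f0 `<=` [set x : R | c <= x] ->
  independent_RV X0 X ->
  (RV_MTP2 (Z_RV X0 X) (Z_density f0 fX) <-> RV_strongly_MTP2 X fX) /\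
  (RV_strongly_MTP2 (Z_RV X0 X) (Z_density f0 fX) <->
     RV_strongly_MTP2_real X0 f0 /\ RV_strongly_MTP2 X fX).
Proof.
move=> _ X0f XfX _ X0X.
have ZZ := Z_has_density X0f XfX X0X.
have [_ f0_ge0 _] := X0f; have [_ fX_ge0 _] := XfX.
have ZX : MTP2 (Z_density f0 fX) -> strongly_MTP2 fX.
  move=> ZM; have [mA A0] := has_density_gt0 X0f.
  have [e e0 eA] := steinhaus mA A0.
  apply: (MTP2_at_extend fX_ge0 e0) => a ae.
  have [s [t [fs ft st]]] := eA a ae; rewrite -st.
  apply: (Z_density_MTP2_at ZM fs ft).
  by rewrite -subr_ge0 st; case/andP: ae.
split; split.
- by move=> [_ ZM]; split => //; exact: ZX.
- by move=> [_ fXM]; split => //; exact: Z_density_MTP2.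
- move=> [_ ZM]; split; split => //; last exact/ZX/strongly_MTP2W.
  (* The set where [fX] is positive has positive measure, hence is nonempty. *)
  have [p fp] : exists p, 0 < fX p.
    apply/not_existsP => nofX; have [_] := has_density_gt0 XfX.
    rewrite (_ : [set x | 0 < fX x] = set0) ?measure0 ?ltxx//.
    by apply/seteqP; split => // x /nofX.
  exact: (Z_density_strongly_MTP2_f0 fp ZM).
- by move=> [[_ f0M] [_ fXM]]; split => //; exact: Z_density_strongly_MTP2.
Qed.
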